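(* Let $(M,g)$ be a Hermitian manifold with torsion-twisted connection $\nabla^T$. A vector field $\zeta\in\Gamma(T^{1,0}M)$ is $\nabla^T$-parallel, i.e. $\nabla^T\zeta=0$, if and only if $\zeta$ is a holomorphic Killing vector field.
   Context: A Hermitian manifold $(M,g)$ is a complex manifold with a Riemannian metric $g$ invariant under the almost complex structure $J$; $g$ is extended complex-bilinearly to $TM\otimes\mathbb{C}=T^{1,0}M\oplus T^{0,1}M$. The Chern connection $\nabla$ is the unique unitary connection on $TM$ with $\nabla^{0,1}=\bar\partial$ on $\Gamma(T^{1,0}M)$. Its torsion is $T(X,Y)=\nabla_XY-\nabla_YX-[X,Y]$. The torsion-twisted connection is $\nabla^T_XY=\nabla_XY-T(X,Y)$, extended to $TM\otimes\mathbb C$; it preserves $T^{1,0}M$. A (complex) vector field $\zeta\in\Gamma(T^{1,0}M)$ is Killing if $\mathcal{L}_\zeta g=0$, where the Lie derivative is extended complex-linearly in $\zeta$. *)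

(* Defs.v *)
From HB Require Import structures.
From mathcomp Require Export all_boot all_order all_algebra complex.
From mathcomp Require Export all_classical all_reals all_analysis.

Set Implicit Arguments.
Unset Strict Implicit.
Unset Printing Implicit Defensive.

Export Order.TTheory GRing.Theory Num.Theory numFieldNormedType.Exports.
Local Open Scope classical_set_scope.
Local Open Scope ring_scope.

Section Calculus.
Context {R : realType}.

(* In finite dimension, f is C^(k+1) on an open set iff it is differentiable
   there and each of its directional derivatives is C^k there. *)
Fixpoint Ck_on {V W : normedModType R} (k : nat) (U : set V) (f : V -> W)
    : Prop :=
  match k with
  | 0 => forall x, U x -> {for x, continuous f}
  | k'.+1 => (forall x, U x -> differentiable f x) /\
             (forall v, Ck_on k' U ('D_v f))
  end.

Definition smooth_on {V W : normedModType R} (U : set V) (f : V -> W) : Prop :=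
  forall k, Ck_on k U f.

Definition re_mx {m : nat} (v : 'rV[R[i]]_m) : 'rV[R]_m :=
  map_mx (@complex.Re R) v.
Definition im_mx {m : nat} (v : 'rV[R[i]]_m) : 'rV[R]_m :=
  map_mx (@complex.Im R) v.
Definition cplx_mx {m : nat} (a b : 'rV[R]_m) : 'rV[R[i]]_m :=
  map_mx (real_complex R) a + 'i%C *: map_mx (real_complex R) b.

(* A row vector (a, b) with a, b of length n is the tangent vector
   \sum_k (a_k d/dx_k + b_k d/dy_k) of C^n; over R[i] it is an element of the
   complexified tangent space. Since J d/dx = d/dy and J d/dy = - d/dx, the
   same formula gives J and its complex-linear extension. *)
Definition Jrow {K : nzRingType} {n : nat} (v : 'rV[K]_(n + n))
    : 'rV[K]_(n + n) :=
  row_mx (- rsubmx v) (lsubmx v).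

Definition dz {n : nat} (v : 'rV[R[i]]_(n + n)) : 'rV[R[i]]_n :=
  lsubmx v + 'i%C *: rsubmx v.

(* \sum_k w_k d/dz_k, where d/dz = (d/dx - i d/dy) / 2. *)
Definition dz_frame {n : nat} (w : 'rV[R[i]]_n) : 'rV[R[i]]_(n + n) :=
  2^-1 *: row_mx w (- ('i%C *: w)).

(* The derivative of F at x along v, complex-linear in both F and v. *)
Definition cderive {d m : nat} (F : 'rV[R]_d -> 'rV[R[i]]_m) (x : 'rV[R]_d)
    (v : 'rV[R[i]]_d) : 'rV[R[i]]_m :=
  let Fr := fun y => re_mx (F y) in
  let Fi := fun y => im_mx (F y) in
  cplx_mx ('D_(re_mx v) Fr x - 'D_(im_mx v) Fi x)
          ('D_(re_mx v) Fi x + 'D_(im_mx v) Fr x).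

(* R^(n + n) is identified with C^n by (x, y) |-> x + i y; a map is holomorphic
   when it is real differentiable with complex-linear differential. *)
Definition holomorphic_on {n m : nat} (U : set 'rV[R]_(n + n))
    (F : 'rV[R]_(n + n) -> 'rV[R[i]]_m) : Prop :=
  forall x, U x ->
    [/\ differentiable (fun y => re_mx (F y)) x,
        differentiable (fun y => im_mx (F y)) x &
        forall v : 'rV[R]_(n + n),
          cderive F x (cplx_mx (Jrow v) 0) = 'i%C *: cderive F x (cplx_mx v 0)].

End Calculus.

Record complex_manifold (R : realType) (n : nat) := ComplexManifold {
  carrier :> topologicalType;
  carrier_hausdorff : hausdorff_space carrier;
  carrier_second_countable : @second_countable carrier;
  chart_index : Type;
  chart_dom : chart_index -> set carrier;
  chart : chart_index -> carrier -> 'rV[R]_(n + n);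
  chart_inv : chart_index -> 'rV[R]_(n + n) -> carrier;
  chart_dom_open : forall a, open (chart_dom a);
  chart_cover : forall p, exists a, chart_dom a p;
  chart_img_open : forall a, open (chart a @` chart_dom a);
  chartK : forall a p, chart_dom a p -> chart_inv a (chart a p) = p;
  chart_continuous : forall a p, chart_dom a p -> {for p, continuous (chart a)};
  chart_inv_continuous : forall a x, (chart a @` chart_dom a) x ->
    {for x, continuous (chart_inv a)};
  transition_smooth : forall a b,
    smooth_on (chart a @` (chart_dom a `&` chart_dom b))
              (chart b \o chart_inv a);
  transition_holomorphic : forall a b,
    holomorphic_on (chart a @` (chart_dom a `&` chart_dom b))
      (fun x => dz (cplx_mx (chart b (chart_inv a x)) 0)) }.

Section Manifold.
Context {R : realType} {n : nat} (M : complex_manifold R n).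

Notation V := 'rV[R]_(n + n).
Notation VC := 'rV[R[i]]_(n + n).

Definition img (a : chart_index M) : set V := @chart _ _ M a @` chart_dom a.

Definition transition (a b : chart_index M) : V -> V :=
  @chart _ _ M b \o @chart_inv _ _ M a.

Definition smooth_fun (f : M -> R) : Prop :=
  forall a, smooth_on (img a) (fun x => f (chart_inv a x) : R^o).

(* A vector field is given by its components in every chart a, as a function
   on the image of a. It is required to vanish outside of this image, so that
   equal fields are represented by equal functions. *)
Definition field_rep : Type := chart_index M -> V -> V.
Definition cfield_rep : Type := chart_index M -> V -> VC.

Record vector_field (X : field_rep) : Prop := VectorField {
  vf_outside : forall a x, ~ img a x -> X a x = 0;
  vf_transform : forall a b p, chart_dom a p -> chart_dom b p ->
    X b (chart b p) = 'D_(X a (chart a p)) (transition a b) (chart a p);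
  vf_smooth : forall a, smooth_on (img a) (X a) }.

Definition re_field (Z : cfield_rep) : field_rep := fun a x => re_mx (Z a x).
Definition im_field (Z : cfield_rep) : field_rep := fun a x => im_mx (Z a x).

Definition cvector_field (Z : cfield_rep) : Prop :=
  vector_field (re_field Z) /\ vector_field (im_field Z).

Definition T10_field (Z : cfield_rep) : Prop :=
  cvector_field Z /\
  forall a x, img a x -> Jrow (Z a x) = 'i%C *: Z a x.

Definition T01_field (Z : cfield_rep) : Prop :=
  cvector_field Z /\
  forall a x, img a x -> Jrow (Z a x) = - ('i%C *: Z a x).

Definition holomorphic_field (Z : cfield_rep) : Prop :=
  T10_field Z /\ forall a, holomorphic_on (img a) (fun x => dz (Z a x)).

(* The operator dbar on sections Z of T^{1,0}M, contracted with X: it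
   differentiates the components of Z in the holomorphic frame d/dz_k. *)
Definition dbar (X Z : cfield_rep) : cfield_rep :=
  fun a x => dz_frame (cderive (fun y => dz (Z a y)) x (X a x)).

Definition addf (X Y : field_rep) : field_rep := fun a x => X a x + Y a x.
Definition scalef (f : M -> R) (X : field_rep) : field_rep :=
  fun a x => f (chart_inv a x) *: X a x.
Definition Jfield (X : field_rep) : field_rep := fun a x => Jrow (X a x).

Definition bracket (X Y : field_rep) : field_rep :=
  fun a x => 'D_(X a x) (Y a) x - 'D_(Y a x) (X a) x.

(* Complex-bilinear extension of an operator on real vector fields. *)
Definition complexify (B : field_rep -> field_rep -> field_rep)
    (Z W : cfield_rep) : cfield_rep :=
  fun a x => cplx_mx
    (B (re_field Z) (re_field W) a x - B (im_field Z) (im_field W) a x)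
    (B (re_field Z) (im_field W) a x + B (im_field Z) (re_field W) a x).

(* The Gram matrices of the metric in every chart. *)
Definition metric_rep : Type := chart_index M -> V -> 'M[R]_(n + n).

Definition inner (G : 'M[R]_(n + n)) (u v : V) : R := (u *m G *m v^T) 0 0.

Record hermitian_metric (g : metric_rep) : Prop := HermitianMetric {
  metric_sym : forall a x u v, img a x ->
    inner (g a x) u v = inner (g a x) v u;
  metric_pos : forall a x u, img a x -> u != 0 -> 0 < inner (g a x) u u;
  metric_J : forall a x u v, img a x ->
    inner (g a x) (Jrow u) (Jrow v) = inner (g a x) u v;
  metric_transform : forall a b p u v, chart_dom a p -> chart_dom b p ->
    inner (g b (chart b p)) ('D_u (transition a b) (chart a p))
                            ('D_v (transition a b) (chart a p))
    = inner (g a (chart a p)) u v;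
  metric_smooth : forall a, smooth_on (img a) (g a) }.

Definition pairing (g : metric_rep) (X Y : field_rep)
    (a : chart_index M) (x : V) : R^o :=
  inner (g a x) (X a x) (Y a x).

Definition lie_metric (g : metric_rep) (X Y Z : field_rep)
    (a : chart_index M) (x : V) : R :=
  'D_(X a x) (pairing g Y Z a) x
  - pairing g (bracket X Y) Z a x - pairing g Y (bracket X Z) a x.

(* L_Z g = 0, with L_Z g = L_(Re Z) g + i L_(Im Z) g. *)
Definition killing (g : metric_rep) (Z : cfield_rep) : Prop :=
  forall Y W, vector_field Y -> vector_field W -> forall a x, img a x ->
    (lie_metric g (re_field Z) Y W a x)%:C%C
    + 'i%C * (lie_metric g (im_field Z) Y W a x)%:C%C = 0.

(* A connection on TM, as an operator on smooth vector fields; nothing is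
   assumed of its values on other arguments. *)
Record connection (D : field_rep -> field_rep -> field_rep) : Prop :=
  Connection {
  conn_field : forall X Y, vector_field X -> vector_field Y ->
    vector_field (D X Y);
  conn_addl : forall X X' Y,
    vector_field X -> vector_field X' -> vector_field Y ->
    forall a x, img a x -> D (addf X X') Y a x = D X Y a x + D X' Y a x;
  conn_scalel : forall f X Y,
    smooth_fun f -> vector_field X -> vector_field Y ->
    forall a x, img a x -> D (scalef f X) Y a x = scalef f (D X Y) a x;
  conn_addr : forall X Y Y',
    vector_field X -> vector_field Y -> vector_field Y' ->
    forall a x, img a x -> D X (addf Y Y') a x = D X Y a x + D X Y' a x;
  conn_leibniz : forall f X Y,
    smooth_fun f -> vector_field X -> vector_field Y ->
    forall a x, img a x ->
      D X (scalef f Y) a x =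
        'D_(X a x) (fun y => f (chart_inv a y) : R^o) x *: Y a x
        + scalef f (D X Y) a x }.

(* Unitary means that both g and J are parallel. *)
Record chern_connection (g : metric_rep)
    (D : field_rep -> field_rep -> field_rep) : Prop := ChernConnection {
  chern_conn : connection D;
  chern_metric : forall X Y Z,
    vector_field X -> vector_field Y -> vector_field Z ->
    forall a x, img a x ->
      'D_(X a x) (pairing g Y Z a) x
      = pairing g (D X Y) Z a x + pairing g Y (D X Z) a x;
  chern_J : forall X Y, vector_field X -> vector_field Y ->
    forall a x, img a x -> D X (Jfield Y) a x = Jfield (D X Y) a x;
  chern_dbar : forall X Z, T01_field X -> T10_field Z ->
    forall a x, img a x -> complexify D X Z a x = dbar X Z a x }.

Definition torsion (D : field_rep -> field_rep -> field_rep)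
    (X Y : field_rep) : field_rep :=
  fun a x => D X Y a x - D Y X a x - bracket X Y a x.

Definition torsion_twisted (D : field_rep -> field_rep -> field_rep)
    (X Y : field_rep) : field_rep :=
  fun a x => D X Y a x - torsion D X Y a x.

(* The extension of D to TM (x) C annihilates Z. *)
Definition parallel (D : field_rep -> field_rep -> field_rep)
    (Z : cfield_rep) : Prop :=
  forall X, cvector_field X -> forall a x, img a x -> complexify D X Z a x = 0.

End Manifold.

(* Main.v *)
From HB Require Import structures.
Require Import Defs.
From mathcomp Require Import ring lra.
Set Implicit Arguments.
Unset Strict Implicit.
Unset Printing Implicit Defensive.
Local Open Scope classical_set_scope.
Local Open Scope ring_scope.

(** The torsion-twisted derivative of a real field [U] along [Y] is
    [A_U Y = nabla_U Y - [U, Y]], the difference of the Chern derivative and the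
    Lie derivative along [U] ([torsion_twistedE]). So [zeta = xi + i eta] is
    parallel iff [A_xi] and [A_eta] vanish on all real fields; being of type
    (1,0), [zeta] satisfies [xi = J eta]. Two identities carry the proof.

    - Since [g] is parallel, [(L_U g)(Y, W) = g(A_U Y, W) + g(Y, A_U W)]
      ([lie_metricE]): [zeta] is Killing iff [A_xi] and [A_eta] are
      skew-symmetric.
    - The condition [nabla^{0,1} = dbar], applied to the fields [U + i JU] of
      type (0,1) and [JY + i Y] of type (1,0), gives
      [A_U Y + A_{JU} JY = D_Y U + J D_{JY} U] in every chart
      ([nabla_sub_lie_dbar]). For [U = eta], the right-hand side vanishes for all
      [Y] iff [zeta] satisfies the Cauchy-Riemann equations.

    If [A_xi = A_eta = 0], both properties follow at once. Conversely, if [zeta]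
    is holomorphic then [A_xi] commutes with [J] and the second identity becomes
    [A_xi = J A_eta]. If [zeta] is moreover Killing, then
    [g(A_eta Y, W) = - g(A_xi JY, W) = g(JY, A_xi W) = g(JY, J A_eta W)
    = g(Y, A_eta W) = - g(A_eta Y, W)], whence [A_eta = 0] and [A_xi = 0].

    In both directions a pointwise conclusion is drawn from hypotheses on global
    fields, so every tangent vector must extend to a global smooth vector field
    ([exists_vector_field]). This takes a bump function, which is cut out of
    [exp (- 1 / t)], and the stability of C^k maps under products and
    compositions. *)

(** * Calculus of C^k maps *)

Section CkCalculus.
Context {R : realType}.
Implicit Types V W : normedModType R.

(** [differentiable] refers to a chosen differential, which makes it no evident
    invariant of the germ; the differential of [f] is shown to be one for [g]. *)
Lemma near_eq_differentiable V W (f g : V -> W) (x : V) :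
  {near x, f =1 g} -> differentiable f x -> differentiable g x.
Proof.
move=> fg df; have /diff_locally/eqaddoP fo := df.
have fgx : f x = g x by exact: nbhs_singleton fg.
have fgs : \forall y \near 0, f (y + x) = g (y + x).
  have := fg; rewrite (near_shift 0) => fg0.
  by apply: filterS fg0 => y; rewrite /= subr0.
have go : g \o shift x = cst (g x) + 'd f x +o_ 0 id.
  apply/eqaddoP => e e0; near=> y.
  suff -> : (g \o shift x - (cst (g x) + 'd f x)) y =
            (f \o shift x - (cst (f x) + 'd f x)) y by near: y; exact: fo.
  have fgy : f (y + x) = g (y + x) by near: y.
  by rewrite !fctE/= fgx fgy.
have cdf := diff_continuous df.
by apply/diff_locallyP; rewrite (diff_unique cdf go).
Unshelve. all: by end_near. Qed.

Lemma Ck_on_eq V W k (U : set V) (f g : V -> W) :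
  open U -> (forall x, U x -> f x = g x) -> Ck_on k U f -> Ck_on k U g.
Proof.
elim: k f g => [|k IH] f g oU fg /=.
  move=> cf x Ux; rewrite /prop_for /continuous_at -fg//.
  apply: cvg_trans (cf x Ux); apply: near_eq_cvg.
  by near=> y; apply: fg; near: y; exact: open_nbhs_nbhs.
move=> [df Df]; split.
  move=> x Ux; apply: near_eq_differentiable (df x Ux).
  by near=> y; apply: fg; near: y; exact: open_nbhs_nbhs.
move=> v; apply: IH (Df v) => // x Ux.
by apply: near_eq_derive; near=> y; apply: fg; near: y; exact: open_nbhs_nbhs.
Unshelve. all: by end_near. Qed.

Lemma Ck_onU V W k (U U' : set V) (f : V -> W) :
  Ck_on k U f -> Ck_on k U' f -> Ck_on k (U `|` U') f.
Proof.
elim: k f => [|k IH] f /=; first by move=> cf cf' x [/cf|/cf'].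
move=> [df Df] [df' Df']; split=> [x [/df|/df']//|v]; exact: IH.
Qed.

Lemma Ck_onW V W k (U : set V) (f : V -> W) : Ck_on k.+1 U f -> Ck_on k U f.
Proof.
elim: k f => [|k IH] f; first by move=> [df _] x /df/differentiable_continuous.
by move=> [df Df]; split => // v; apply: IH.
Qed.

Lemma Ck_on_cst V W k (U : set V) (c : W) : Ck_on k U (fun=> c : W).
Proof.
elim: k c => [|k IH] c /=; first by move=> x _; exact: cst_continuous.
split=> [x _|v]; first exact: differentiable_cst.
by rewrite (_ : 'D_v _ = fun=> 0)//; apply/funext => x; exact: derive_cst.
Qed.

Lemma Ck_onD V W k (U : set V) (f g : V -> W) :
  open U -> Ck_on k U f -> Ck_on k U g -> Ck_on k U (fun x => f x + g x).
Proof.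
move=> oU; elim: k f g => [|k IH] f g /=.
  by move=> cf cg x Ux; apply: cvgD; [exact: cf|exact: cg].
move=> [df Df] [dg Dg]; split=> [x Ux|v].
  by apply: differentiableD; [exact: df|exact: dg].
apply: (Ck_on_eq (f := fun x => 'D_v f x + 'D_v g x)) => //; last exact: IH.
move=> x Ux.
by rewrite -deriveD//; apply: diff_derivable; [exact: df|exact: dg].
Qed.

Lemma Ck_on_sum V W k (U : set V) (I : Type) (r : seq I) (f : I -> V -> W) :
  open U -> (forall i, Ck_on k U (f i)) ->
  Ck_on k U (fun x => \sum_(i <- r) f i x).
Proof.
move=> oU fk; elim: r => [|i r IH].
  by under eq_fun do rewrite big_nil; exact: Ck_on_cst.
by under eq_fun do rewrite big_cons; exact: Ck_onD.
Qed.

Lemma derive_linear_comp V W (Z : normedModType R) (L : {linear W -> Z})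
    (f : V -> W) (x v : V) :
  continuous L -> differentiable f x ->
  'D_v (fun y => L (f y)) x = L ('D_v f x).
Proof.
move=> cL df; have dL : differentiable L (f x) by exact: linear_differentiable.
rewrite (deriveE _ (f := L \o f)); last exact: differentiable_comp.
by rewrite diff_comp//= diff_lin// deriveE.
Qed.

Lemma Ck_on_linear_comp V W (Z : normedModType R) k (U : set V)
    (L : {linear W -> Z}) (f : V -> W) :
  open U -> continuous L -> Ck_on k U f -> Ck_on k U (fun y => L (f y)).
Proof.
move=> oU cL; elim: k f => [|k IH] f /=.
  move=> cf x Ux; apply: (@continuous_comp _ _ _ f L); [exact: cf|exact: cL].
move=> [df Df]; split=> [x Ux|v].
  apply: (differentiable_comp (f := f)); first exact: df.
  exact: linear_differentiable.
apply: (Ck_on_eq (f := fun x => L ('D_v f x))) => //; last exact: IH.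
by move=> x Ux; rewrite derive_linear_comp//; exact: df.
Qed.

Lemma Ck_onM V k (U : set V) (f g : V -> R^o) :
  open U -> Ck_on k U f -> Ck_on k U g -> Ck_on k U (fun x => f x * g x : R^o).
Proof.
move=> oU; elim: k f g => [|k IH] f g.
  by move=> cf cg x Ux; apply: cvgM; [exact: cf|exact: cg].
move=> fk gk; have [[df Df] [dg Dg]] := (fk, gk); split=> [x Ux|v].
  by apply: differentiableM; [exact: df|exact: dg].
apply: (Ck_on_eq (f := fun x => f x * 'D_v g x + g x * 'D_v f x : R^o)) => //.
  move=> x Ux; rewrite [RHS](deriveM (f := f) (g := g))//; apply: diff_derivable.
    exact: df.
  exact: dg.
by apply: Ck_onD => //; apply: IH; by [exact: Ck_onW|exact: Df|exact: Dg].
Qed.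

Lemma Ck_on_prod V k (U : set V) (I : Type) (r : seq I) (f : I -> V -> R^o) :
  open U -> (forall i, Ck_on k U (f i)) ->
  Ck_on k U (fun x => \prod_(i <- r) f i x : R^o).
Proof.
move=> oU fk; elim: r => [|i r IH].
  by under eq_fun do rewrite big_nil; exact: Ck_on_cst.
by under eq_fun do rewrite big_cons; exact: Ck_onM.
Qed.

Lemma Ck_on_scalel V W (c : V -> R^o) (w : W) k U :
  open U -> Ck_on k U c -> Ck_on k U (fun x => c x *: w).
Proof.
move=> oU; have sl : linear (fun t : R^o => t *: w).
  by move=> a t s; rewrite scalerDl scalerA.
pose S : {linear R^o -> W} :=
  HB.pack (fun t : R^o => t *: w) (GRing.isLinear.Build _ _ _ _ _ sl).
apply: (Ck_on_linear_comp (L := S)) => //; exact: scalel_continuous.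
Qed.

Lemma Ck_on_coord V m k (U : set V) (f : V -> 'rV[R]_m) j :
  open U -> Ck_on k U f -> Ck_on k U (fun x => f x 0 j : R^o).
Proof.
move=> oU; have cl : linear (fun M : 'rV[R]_m => M 0 j : R^o).
  by move=> a A B; rewrite !mxE.
pose C : {linear 'rV[R]_m -> R^o} :=
  HB.pack (fun M : 'rV[R]_m => M 0 j : R^o) (GRing.isLinear.Build _ _ _ _ _ cl).
by apply: (Ck_on_linear_comp (L := C)) => //; exact: coord_continuous.
Qed.

Lemma Ck_on_rV V m k (U : set V) (f : V -> 'rV[R]_m) :
  open U -> (forall j, Ck_on k U (fun x => f x 0 j : R^o)) -> Ck_on k U f.
Proof.
move=> oU fk.
rewrite (_ : f = fun x => \sum_j f x 0 j *: delta_mx 0 j); last first.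
  by apply/funext => x; exact: row_sum_delta.
by apply: Ck_on_sum => // j; exact: Ck_on_scalel.
Qed.

Lemma Ck_onZ V m k (U : set V) (c : V -> R^o) (f : V -> 'rV[R]_m) :
  open U -> Ck_on k U c -> Ck_on k U f -> Ck_on k U (fun x => c x *: f x).
Proof.
move=> oU ck fk; apply: Ck_on_rV => // j; under eq_fun do rewrite mxE.
by apply: Ck_onM => //; exact: Ck_on_coord.
Qed.

Lemma derive_sum_delta W m (g : 'rV[R]_m -> W) (x v : 'rV[R]_m) :
  differentiable g x -> 'D_v g x = \sum_j v 0 j *: 'D_(delta_mx 0 j) g x.
Proof.
move=> dg; rewrite deriveE// {1}(row_sum_delta v) linear_sum.
by apply: eq_bigr => j _; rewrite linearZ/= deriveE.
Qed.

Lemma derive_comp V W (Z : normedModType R) (f : V -> W) (g : W -> Z)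
    (x v : V) :
  differentiable f x -> differentiable g (f x) ->
  'D_v (g \o f) x = 'D_('D_v f x) g (f x).
Proof.
move=> df dg; rewrite deriveE; last exact: differentiable_comp.
by rewrite diff_comp//= !deriveE.
Qed.

(** By the chain rule each directional derivative of [g \o f] is a sum of
    products of a coordinate of a derivative of [f] with a partial derivative of
    [g] composed with [f]; the latter is why the induction is on all [g]. *)
Lemma Ck_on_comp V m p k (U : set V) (U' : set 'rV[R]_m) (f : V -> 'rV[R]_m)
    (g : 'rV[R]_m -> 'rV[R]_p) :
  open U -> f @` U `<=` U' -> Ck_on k U f -> Ck_on k U' g ->
  Ck_on k U (g \o f).
Proof.
move=> oU fU; elim: k g => [|k IH] g.
  move=> cf cg x Ux; apply: (@continuous_comp _ _ _ f g); first exact: cf.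
  by apply: cg; apply: fU; exists x.
move=> fk gk; have [[df Df] [dg Dg]] := (fk, gk).
have dgf x : U x -> differentiable g (f x) by move=> Ux; apply/dg/fU; exists x.
split=> [x Ux|v].
  by apply: (differentiable_comp (f := f)); [exact: df|exact: dgf].
apply: (Ck_on_eq (f := fun x => \sum_j
    ('D_v f x) 0 j *: (('D_(delta_mx 0 j) g) \o f) x)) => //.
  move=> x Ux; rewrite (derive_comp _ (df x Ux) (dgf x Ux)).
  by rewrite (derive_sum_delta _ (dgf x Ux)).
apply: Ck_on_sum => // j; apply: Ck_onZ => //.
  by apply: Ck_on_coord => //; exact: Df.
by apply: IH; [exact: Ck_onW|exact: Dg].
Qed.

End CkCalculus.

(** * Smooth bump functions *)

Section Bump.
Context {R : realType}.

(** The functions [t^-k exp(-1/t)], extended by 0 to [t <= 0]. The derivative of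
    each is a linear combination of two others, so all of them are smooth by a
    single induction. *)
Definition flat (k : nat) (t : R) : R :=
  if 0 < t then t ^- k * expR (- t^-1) else 0.

Lemma flat_ge0 k t : 0 <= flat k t.
Proof.
rewrite /flat; case: ifP => // t0.
by rewrite mulr_ge0 ?expR_ge0// invr_ge0 exprn_ge0// ltW.
Qed.

Lemma flatS k t : flat k t = t * flat k.+1 t.
Proof.
rewrite /flat; case: ifP => [t0|]; last by rewrite mulr0.
by rewrite mulrA exprS invfM mulVKf// gt_eqF.
Qed.

(** From [t^-(k+1) / (k+1)! <= exp(1/t)]. A linear bound for every [k] suffices
    for differentiability at 0, because the difference quotient of [flat k] there
    is [flat k.+1]. *)
Lemma flat_bounded k t : flat k t <= k.+1`!%:R * `|t|.
Proof.
rewrite /flat; case: ifP => [t0|_]; last by rewrite mulr_ge0.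
rewrite gtr0_norm// expRN -invfM.
have e0 := expR_gt0 t^-1.
have f0 : 0 < k.+1`!%:R :> R by rewrite ltr0n fact_gt0.
rewrite -[X in X <= _]mul1r ler_pdivrMr ?mulr_gt0 ?exprn_gt0//.
have := @expR_ge1Dxn R t^-1 k; rewrite invr_ge0 ltW// => /(_ isT) H.
have {}H : t ^- k.+1 / k.+1`!%:R <= expR t^-1.
  by apply: le_trans H; rewrite -exprVn lerDr.
have := ler_wpM2l (ltW (mulr_gt0 f0 (exprn_gt0 k.+1 t0))) H.
rewrite -invfM [_ * t ^+ _]mulrC mulfV ?mulf_neq0 ?expf_neq0 ?gt_eqF//.
rewrite exprS => /le_trans; apply.
by rewrite [leLHS](_ : _ = k.+1`!%:R * t * (t ^+ k * expR t^-1))//; ring.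
Qed.

Lemma is_derive_flat k (t : R) :
  is_derive t (1 : R) (flat k) (flat k.+2 t - k%:R * flat k.+1 t).
Proof.
have [t0|t0|->] := ltgtP t 0.
- have f0 : \near t, cst (0 : R) t = flat k t.
    near=> s; rewrite /flat ifN// -leNgt ltW//; near: s.
    exact: lt_nbhsl.
  apply: near_eq_is_derive f0 _.
  by rewrite /flat !ifN -?leNgt ?ltW// mulr0 subr0; exact: is_derive_cst.
- have ft : \near t, t ^- k * expR (- t^-1) = flat k t.
    near=> s; rewrite /flat ifT//; near: s.
    exact: lt_nbhsr.
  apply: near_eq_is_derive ft _.
  rewrite /flat !ifT//.
  have tn0 : t != 0 by rewrite gt_eqF.
  have dV : is_derive t (1 : R) (fun s : R => s^-1) (- t ^- 2).
    have -> : - t ^- 2 = - (id t) ^- 2 *: (1 : R) by rewrite /= [_ *: _]mulr1.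
    exact: (is_deriveV (f := id)).
  have dE : is_derive t (1 : R) (fun s : R => expR (- s^-1))
      (expR (- t^-1) * t ^- 2).
    have dN : is_derive t (1 : R) (fun s : R => - s^-1) (t ^- 2).
      by rewrite -[t ^- 2]opprK; exact: is_deriveN.
    exact: (is_derive1_comp (f := expR)).
  have -> : (fun s : R => s ^- k * expR (- s^-1)) =
            (fun s : R => s^-1) ^+ k * (fun s : R => expR (- s^-1)).
    by apply/funext => s; rewrite !fctE exprVn.
  apply: is_derive_eq.
  rewrite /GRing.scale/= !fctE.
  rewrite -!exprVn; case: (k) => [|j] /=; rewrite !exprS; ring.
- have f00 j : flat j 0 = 0 by rewrite /flat ltxx.
  rewrite !f00 mulr0 subr0.
  have cf : (fun h : R => h^-1 *: ((flat k \o shift 0) (h *: 1) - flat k 0))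
      @ 0^' --> (0 : R).
    apply/cvgr0Pnorm_le => e e0; near=> h.
    have hn0 : h != 0 by near: h; exact: nbhs_dnbhs_neq.
    rewrite f00 /= addr0 subr0 [h *: 1]mulr1 flatS [_ *: _]mulKf//.
    rewrite ger0_norm ?flat_ge0//.
    apply: le_trans (flat_bounded _ _) _.
    rewrite -ler_pdivlMl ?ltr0n ?fact_gt0//; near: h.
    apply: dnbhs0_le; rewrite mulr_gt0// invr_gt0 ltr0n fact_gt0//.
  by split; [apply/cvg_ex; exists 0|exact: cvg_lim].
Unshelve. all: by end_near. Qed.

Lemma differentiable_coord_aff m (c s : R) (i : 'I_m) (x : 'rV[R]_m) :
  differentiable (fun y : 'rV[R]_m => c + s * y 0 i : R^o) x.
Proof.
apply: differentiableD; first exact: differentiable_cst.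
apply: (differentiableZ (f := fun y : 'rV[R]_m => y 0 i)).
exact: differentiable_coord.
Qed.

Lemma derive_coord_aff m (c s : R) (i : 'I_m) (x v : 'rV[R]_m) :
  'D_v (fun y : 'rV[R]_m => c + s * y 0 i : R^o) x = s * v 0 i.
Proof.
pose f := fun y : 'rV[R]_m => y 0 i.
have df : derivable f x v by exact/diff_derivable/differentiable_coord.
rewrite deriveD; last 2 first.
- exact: derivable_cst.
- exact: (derivableZ (f := f)).
rewrite derive_cst add0r (deriveZ (f := f))//.
congr (_ * _).
have := @derive_mx _ _ _ _ id x v (@derivable_id _ _ x v).
by rewrite derive_id => /matrixP /(_ 0 i); rewrite mxE => <-.
Qed.

Lemma Ck_on_flat_aff m (c s : R) (i : 'I_m) j k :
  Ck_on k setT (fun y : 'rV[R]_m => flat j (c + s * y 0 i) : R^o).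
Proof.
have dfl l (t : R^o) : differentiable (flat l : R^o -> R^o) t.
  by apply/derivable1_diffP; case: (is_derive_flat l t).
have dfla l x :
    differentiable (fun y : 'rV[R]_m => flat l (c + s * y 0 i) : R^o) x.
  apply: (differentiable_comp (f := fun y : 'rV[R]_m => c + s * y 0 i : R^o)
     (g := flat l : R^o -> R^o)) => //.
  exact: differentiable_coord_aff.
elim: k j => [|k IH] j; first by move=> x _; exact: differentiable_continuous.
split=> // v.
have oT : open [set: 'rV[R]_m] by exact: openT.
apply: (Ck_on_eq (f := fun y : 'rV[R]_m => (s * v 0 i) *
    (flat j.+2 (c + s * y 0 i) + - j%:R * flat j.+1 (c + s * y 0 i)) : R^o)) => //.
  move=> x _; rewrite mulNr.
  have [_ <-] := is_derive_flat j (c + s * x 0 i).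
  have -> := derive_comp (f := fun y : 'rV[R]_m => c + s * y 0 i : R^o)
     (g := flat j : R^o -> R^o) v (differentiable_coord_aff c s i x) (dfl _ _).
  rewrite derive_coord_aff [RHS]deriveE// [in LHS]deriveE//.
  by rewrite -[in RHS](mulr1 (s * v 0 i)) -/(_ *: (1 : R^o)) linearZ.
apply: Ck_onM => //; first exact: Ck_on_cst.
apply: Ck_onD => //; apply: Ck_onM => //; exact: Ck_on_cst.
Qed.

Lemma flat_gt0 k t : 0 < t -> 0 < flat k t.
Proof.
by move=> t0; rewrite /flat t0 mulr_gt0 ?expR_gt0// invr_gt0 exprn_gt0.
Qed.

Lemma flat_le0 k t : t <= 0 -> flat k t = 0.
Proof. by move=> t0; rewrite /flat ltNge t0. Qed.

(** A product over the coordinates of the bumps [flat 0 (r - s) * flat 0 (r + s)],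
    where [s] is the displacement from the centre; such a bump is positive for
    [|s| < r] and 0 elsewhere. The arguments of [flat] are thus affine functions,
    and no composition with a nonlinear map occurs. *)
Lemma smooth_bump m (U : set 'rV[R]_m) (x0 : 'rV[R]_m) :
  open U -> U x0 ->
  exists2 K : set 'rV[R]_m, compact K /\ K `<=` U &
  exists phi : 'rV[R]_m -> R^o, [/\ smooth_on setT phi, phi x0 = 1 &
    forall x, ~ K x -> phi x = 0].
Proof.
move=> oU Ux0.
have /nbhs_ballP[e /= e0 eU] : nbhs x0 U by exact: open_nbhs_nbhs (conj oU Ux0).
pose r := e / 2; have r0 : 0 < r by rewrite divr_gt0.
exists [set x : 'rV[R]_m | forall i, `[x0 0 i - r, x0 0 i + r]%classic (x 0 i)].
  split.
    apply: (@rV_compact _ _ (fun i => `[x0 0 i - r, x0 0 i + r]%classic)).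
    by move=> i; exact: segment_compact.
  move=> x xK; apply: eU; split => // i j; rewrite ord1 {i}.
  have := xK j; rewrite /= in_itv/= => /andP[xl xr].
  have re : r < e by rewrite /r ltr_pdivrMr// ltr_pMr// ltr1n.
  by rewrite /ball/= ltr_norml; lra.
pose psi := fun x : 'rV[R]_m => \prod_(i < m)
  (flat 0 (r - x0 0 i + 1 * x 0 i) * flat 0 (r + x0 0 i + (- 1) * x 0 i)) : R^o.
have psi0 : 0 < psi x0.
  by rewrite /psi; apply: prodr_gt0 => i _; rewrite mulr_gt0// flat_gt0//; lra.
exists (fun x => (psi x0)^-1 * psi x : R^o); split => [k||x nK].
- apply: Ck_onM; [exact: openT|exact: Ck_on_cst|].
  apply: Ck_on_prod; first exact: openT.
  by move=> i; apply: Ck_onM; [exact: openT| |]; exact: Ck_on_flat_aff.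
- by rewrite mulVf// gt_eqF.
- have [i ni] : exists i, ~ `[x0 0 i - r, x0 0 i + r]%classic (x 0 i).
    by apply/not_existsP => H; apply: nK => i; apply: contrapT; exact: H.
  suff -> : psi x = 0 by rewrite mulr0.
  rewrite /psi (bigD1 i)//=; move: ni; rewrite /= in_itv/= => /negP.
  rewrite negb_and -!ltNge => /orP[h|h].
    have -> : flat 0 (r - x0 0 i + 1 * x 0 i) = 0 by apply: flat_le0; lra.
    by rewrite !mul0r.
  have -> : flat 0 (r + x0 0 i + (- 1) * x 0 i) = 0 by apply: flat_le0; lra.
  by rewrite mulr0 mul0r.
Qed.
End Bump.

(** * Global extension of tangent vectors *)

Section Extension.
Context {R : realType} {n : nat} (M : complex_manifold R n).
Notation V := 'rV[R]_(n + n).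
Implicit Types (a b c : chart_index M) (p : M).

Lemma img_open a : open (img a).
Proof. exact: chart_img_open. Qed.

Lemma chart_img a p : chart_dom a p -> img a (chart a p).
Proof. by exists p. Qed.

Lemma img_chart_inv a x : img a x -> chart_dom a (chart_inv a x).
Proof. by move=> [p pa <-]; rewrite chartK. Qed.

Lemma open_chart_preimage a (O : set M) :
  open O -> open (img a `&` chart_inv a @^-1` O).
Proof.
move=> oO; rewrite openE => x [xa Ox]; apply: filterI.
  by apply: open_nbhs_nbhs; split=> //; exact: img_open.
by apply: (chart_inv_continuous xa); apply: open_nbhs_nbhs.
Qed.

Lemma overlap_img a b :
  chart a @` (chart_dom a `&` chart_dom b) =
  img a `&` chart_inv a @^-1` chart_dom b.
Proof.
apply/seteqP; split=> x.
  by move=> [p [pa pb] <-]; split; [exists p|rewrite /= chartK].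
by move=> [[p pa <-]]; rewrite /= chartK// => pb; exists p.
Qed.

Lemma overlap_open a b : open (chart a @` (chart_dom a `&` chart_dom b)).
Proof. by rewrite overlap_img; apply/open_chart_preimage/chart_dom_open. Qed.

Lemma transition_differentiable a b p :
  chart_dom a p -> chart_dom b p -> differentiable (transition a b) (chart a p).
Proof.
by move=> pa pb; have [+ _] := transition_smooth a b 1; apply; exists p.
Qed.

Lemma near_overlap a b p (P : V -> Prop) :
  chart_dom a p -> chart_dom b p ->
  (forall q, chart_dom a q -> chart_dom b q -> P (chart a q)) ->
  \forall x \near chart a p, P x.
Proof.
move=> pa pb PP.
have : nbhs (chart a p) (chart a @` (chart_dom a `&` chart_dom b)).
  by apply: open_nbhs_nbhs; split; [exact: overlap_open|exists p].
by apply: filterS => x [q [qa qb] <-]; exact: PP.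
Qed.

Lemma transition_cocycle a b c p v :
  chart_dom a p -> chart_dom b p -> chart_dom c p ->
  'D_('D_v (transition a b) (chart a p)) (transition b c) (chart b p) =
  'D_v (transition a c) (chart a p).
Proof.
move=> pa pb pc.
have ab : transition a b (chart a p) = chart b p by rewrite /transition/= chartK.
rewrite -ab -derive_comp; last 2 first.
- exact: transition_differentiable.
- by rewrite ab; exact: transition_differentiable.
apply: near_eq_derive; apply: (near_overlap pa pb) => q qa qb.
by rewrite /transition/= !chartK.
Qed.

Lemma derive_transition_id a p v :
  chart_dom a p -> 'D_v (transition a a) (chart a p) = v.
Proof.
move=> pa; rewrite -[RHS](derive_id (chart a p) v).
apply: near_eq_derive; apply: (near_overlap pa pa) => q qa _.
by rewrite /transition/= !chartK.
Qed.

(** The push-forward to all charts of a field [F] given in the chart [a],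
    extended by 0. *)
Definition extend_field a (F : V -> V) : field_rep M := fun b y =>
  if `[< img b y /\ chart_dom a (chart_inv b y) >]
  then 'D_(F (transition b a y)) (transition a b) (transition b a y) else 0.

Lemma extend_fieldE a F b p : chart_dom a p -> chart_dom b p ->
  extend_field a F b (chart b p) =
  'D_(F (chart a p)) (transition a b) (chart a p).
Proof.
move=> pa pb; rewrite /extend_field /transition/= chartK// asboolT//.
by split=> //; exact: chart_img.
Qed.

Lemma extend_field0 a F b p : ~ chart_dom a p -> chart_dom b p ->
  extend_field a F b (chart b p) = 0.
Proof. by move=> pa pb; rewrite /extend_field /= chartK// asboolF// => -[]. Qed.

(** Smoothness near a point outside the chart [a]: the points of [M] that come
    from the support [K] form a compact, hence closed, set by the Hausdorff
    property, and the field vanishes on its complement. *)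
Lemma extend_field_vector_field a (F : V -> V) (K : set V) :
  smooth_on setT F -> compact K -> K `<=` img a ->
  (forall x, ~ K x -> F x = 0) ->
  vector_field (extend_field a F).
Proof.
move=> sF cK Ka F0; split.
- by move=> b x nb; rewrite /extend_field asboolF// => -[].
- move=> b c p pb pc; have [pa|pa] := pselect (chart_dom a p).
    by rewrite !extend_fieldE// transition_cocycle.
  by rewrite !extend_field0// derive0.
move=> b k.
pose C := chart_inv a @` K.
have Cclosed : closed C.
  apply: compact_closed; first exact: carrier_hausdorff.
  apply: continuous_compact cK; apply: continuous_in_subspaceT => x.
  by rewrite inE => /Ka; exact: chart_inv_continuous.
have -> : img b = (chart b @` (chart_dom b `&` chart_dom a)) `|`
                  (img b `&` chart_inv b @^-1` (~` C)).
  apply/seteqP; split=> x; last first.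
    by case=> [[p [pb _] <-]|[]//]; exact: chart_img.
  move=> [p pb <-]; have [pa|pa] := pselect (chart_dom a p).
    by left; exists p.
  right; split; first exact: chart_img.
  rewrite /= chartK// => -[y /Ka ya yp]; apply: pa; rewrite -yp.
  exact: img_chart_inv.
apply: Ck_onU.
  pose Uba := chart b @` (chart_dom b `&` chart_dom a).
  have oba : open Uba by exact: overlap_open.
  pose f := fun y => \sum_j (F (transition b a y)) 0 j *:
     ('D_(delta_mx 0 j) (transition a b) \o transition b a) y.
  apply: (Ck_on_eq (f := f)) => //.
    move=> _ [p [pb pa] <-]; rewrite extend_fieldE// /f /transition/= chartK//.
    by rewrite [RHS]derive_sum_delta//; exact: transition_differentiable.
  have sba : Ck_on k Uba (transition b a) by exact: transition_smooth.
  apply: Ck_on_sum => // j; apply: Ck_onZ => //.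
    apply: Ck_on_coord => //.
    by apply: (Ck_on_comp (g := F) (U' := setT) (f := transition b a)).
  apply: (Ck_on_comp (f := transition b a)
    (U' := chart a @` (chart_dom a `&` chart_dom b))) => //.
    move=> _ [_ [p [pb pa] <-] <-]; rewrite /transition/= chartK//.
    by exists p.
  by have [_] := transition_smooth a b k.+1; apply.
have oC : open (img b `&` chart_inv b @^-1` (~` C)).
  by apply: open_chart_preimage; exact: closed_openC.
apply: (Ck_on_eq (f := fun=> 0)) => //; last exact: Ck_on_cst.
move=> _ [[p pb <-]]; rewrite /= chartK// => nC.
have [pa|pa] := pselect (chart_dom a p); last by rewrite extend_field0.
rewrite extend_fieldE// F0 ?derive0// => Kp; apply: nC.
by exists (chart a p) => //; rewrite chartK.
Qed.

Lemma exists_vector_field a x v : img a x ->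
  exists2 Y : field_rep M, vector_field Y & Y a x = v.
Proof.
move=> xa.
have [K [cK Ka] [phi [sphi phi1 phi0]]] := smooth_bump (@img_open a) xa.
pose F := fun x : V => phi x *: v.
exists (extend_field a F).
  apply: (extend_field_vector_field (K := K)) => //.
    by move=> k; apply: Ck_onZ; [exact: openT|exact: sphi|exact: Ck_on_cst].
  by move=> y /phi0; rewrite /F => ->; rewrite scale0r.
move: xa phi1 => [p pa <-] phi1.
by rewrite extend_fieldE// derive_transition_id// /F phi1 scale1r.
Qed.

End Extension.

(** * Complexified vectors and the complex structure *)

Section ComplexVectors.
Context {R : realType}.

Lemma Jrow_is_linear (K : nzRingType) n : linear (@Jrow K n).
Proof.
by move=> c u v; rewrite /Jrow !linearP scale_row_mx add_row_mx.
Qed.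

HB.instance Definition _ (K : nzRingType) n :=
  GRing.isLinear.Build K 'rV[K]_(n + n) 'rV[K]_(n + n) *:%R (@Jrow K n)
    (@Jrow_is_linear K n).

Lemma JrowK (K : nzRingType) n (v : 'rV[K]_(n + n)) : Jrow (Jrow v) = - v.
Proof.
by rewrite /Jrow row_mxKl row_mxKr -{3}[v]hsubmxK opp_row_mx.
Qed.

Lemma rV_linear_continuous m (W : normedModType R)
    (L : {linear 'rV[R]_m -> W}) :
  continuous L.
Proof.
have oT : open [set: 'rV[R]_m] by exact: openT.
have -> : (L : _ -> W) = fun x => \sum_j x 0 j *: L (delta_mx 0 j).
  apply/funext => x; rewrite {1}(row_sum_delta x) linear_sum.
  by apply: eq_bigr => j _; rewrite linearZ.
suff C0 : Ck_on 0 setT (fun x : 'rV[R]_m => \sum_j x 0 j *: L (delta_mx 0 j)).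
  by move=> x; exact: C0.
apply: Ck_on_sum => // j.
apply: Ck_on_scalel => //; apply: (Ck_on_coord (f := id)) => //.
by move=> y _; exact: cvg_id.
Qed.

Lemma re_cplx m (a b : 'rV[R]_m) : re_mx (cplx_mx a b) = a.
Proof. by apply/rowP => j; rewrite !mxE/=; ring. Qed.

Lemma im_cplx m (a b : 'rV[R]_m) : im_mx (cplx_mx a b) = b.
Proof. by apply/rowP => j; rewrite !mxE/=; ring. Qed.

Lemma cplx_re_im m (v : 'rV[R[i]]_m) : cplx_mx (re_mx v) (im_mx v) = v.
Proof.
apply/rowP => j; rewrite !mxE; case: (v 0 j) => a b; apply/eqP.
by rewrite eq_complex /=; apply/andP; split; apply/eqP; ring.
Qed.

Lemma cplx_eq m (a b a' b' : 'rV[R]_m) :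
  cplx_mx a b = cplx_mx a' b' <-> a = a' /\ b = b'.
Proof.
split=> [e|[-> ->]//]; split.
  by rewrite -(re_cplx a b) e re_cplx.
by rewrite -(im_cplx a b) e im_cplx.
Qed.

Lemma scale_i_cplx m (a b : 'rV[R]_m) : 'i%C *: cplx_mx a b = cplx_mx (- b) a.
Proof.
apply/rowP => j; rewrite !mxE; apply/eqP.
by rewrite eq_complex /=; apply/andP; split; apply/eqP; ring.
Qed.

Lemma opp_cplx m (a b : 'rV[R]_m) : - cplx_mx a b = cplx_mx (- a) (- b).
Proof.
apply/rowP => j; rewrite !mxE; apply/eqP.
by rewrite eq_complex /=; apply/andP; split; apply/eqP; ring.
Qed.

Lemma Jrow_cplx n (a b : 'rV[R]_(n + n)) :
  Jrow (cplx_mx a b) = cplx_mx (Jrow a) (Jrow b).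
Proof.
apply/rowP => j; rewrite !mxE.
case: (fintype.split j) => k; rewrite !mxE//; apply/eqP;
by rewrite eq_complex /=; apply/andP; split; apply/eqP; ring.
Qed.

Lemma dz_cplx n (a b : 'rV[R]_(n + n)) :
  dz (cplx_mx a b) = cplx_mx (lsubmx a - rsubmx b) (lsubmx b + rsubmx a).
Proof.
apply/rowP => j; rewrite !mxE; apply/eqP.
by rewrite eq_complex /=; apply/andP; split; apply/eqP; ring.
Qed.

(** In the frame [d/dz_k], the vector [J b + i b] has components
    [2 i (b_k + i b_(n+k))]. *)
Lemma dz_type10 n (b : 'rV[R]_(n + n)) :
  dz (cplx_mx (Jrow b) b) = cplx_mx (- (2 *: rsubmx b)) (2 *: lsubmx b).
Proof.
rewrite dz_cplx /Jrow row_mxKl row_mxKr scaler_nat mulr2n opprD scaler_nat.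
by rewrite mulr2n.
Qed.

Lemma im_dz_frame n (a b : 'rV[R]_n) :
  im_mx (dz_frame (cplx_mx a b)) = 2^-1 *: row_mx b (- a).
Proof.
apply/rowP => j; rewrite !mxE.
have -> : (2^-1 : R[i]) = (2^-1)%:C%C.
  by rewrite -(rmorph_nat (real_complex R)) -fmorphV.
by case: (fintype.split j) => k; rewrite !mxE/=; ring.
Qed.

End ComplexVectors.

(** * Cauchy-Riemann equations *)

Section Holomorphy.
Context {R : realType}.

Lemma derive_lin m p (L : {linear 'rV[R]_m -> 'rV[R]_p}) d
    (f : 'rV[R]_d -> 'rV[R]_m) x v :
  differentiable f x -> 'D_v (fun y => L (f y)) x = L ('D_v f x).
Proof. exact/derive_linear_comp/rV_linear_continuous. Qed.

Lemma differentiable_lin m p (L : {linear 'rV[R]_m -> 'rV[R]_p}) d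
    (f : 'rV[R]_d -> 'rV[R]_m) x :
  differentiable f x -> differentiable (fun y => L (f y)) x.
Proof.
move=> df; apply: (differentiable_comp (f := f)) => //.
exact/linear_differentiable/rV_linear_continuous.
Qed.

Lemma cderive_cplx d m (f h : 'rV[R]_d -> 'rV[R]_m) x u v :
  cderive (fun y => cplx_mx (f y) (h y)) x (cplx_mx u v) =
  cplx_mx ('D_u f x - 'D_v h x) ('D_u h x + 'D_v f x).
Proof.
rewrite /cderive re_cplx im_cplx.
have -> : (fun y => re_mx (cplx_mx (f y) (h y))) = f.
  by apply/funext => y; rewrite re_cplx.
have -> // : (fun y => im_mx (cplx_mx (f y) (h y))) = h.
by apply/funext => y; rewrite im_cplx.
Qed.

Lemma complex_linear_cderive n m (F : 'rV[R]_(n + n) -> 'rV[R[i]]_m)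
    (f h : 'rV[R]_(n + n) -> 'rV[R]_m) x v :
  F = (fun y => cplx_mx (f y) (h y)) ->
  (cderive F x (cplx_mx (Jrow v) 0) = 'i%C *: cderive F x (cplx_mx v 0) <->
   'D_(Jrow v) f x = - 'D_v h x /\ 'D_(Jrow v) h x = 'D_v f x).
Proof.
move=> ->; rewrite !cderive_cplx !derive0 !subr0 !addr0 scale_i_cplx.
exact: cplx_eq.
Qed.

(** A holomorphic map, seen as a map of the real coordinates, has a differential
    that commutes with [J]. *)
Lemma holomorphic_derive_J n (U : set 'rV[R]_(n + n))
    (f : 'rV[R]_(n + n) -> 'rV[R]_(n + n)) x v :
  holomorphic_on U (fun y => dz (cplx_mx (f y) 0)) ->
  U x -> differentiable f x ->
  'D_(Jrow v) f x = Jrow ('D_v f x).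
Proof.
move=> hf Ux df; have [_ _ /(_ v)] := hf x Ux.
have -> : (fun y => dz (cplx_mx (f y) 0)) =
          (fun y => cplx_mx (lsubmx (f y)) (rsubmx (f y))).
  by apply/funext => y; rewrite dz_cplx !(linear0, subr0, addr0, add0r).
move=> /(complex_linear_cderive _ _ erefl).
rewrite !(derive_lin lsubmx) // !(derive_lin (rsubmx)) // => -[l r].
by rewrite -[LHS]hsubmxK l r.
Qed.

(** The Cauchy-Riemann equations of [J f + i f] read off its imaginary part. *)
Lemma holomorphic_type10 n (U : set 'rV[R]_(n + n))
    (f : 'rV[R]_(n + n) -> 'rV[R]_(n + n)) :
  (forall x, U x -> differentiable f x) ->
  (holomorphic_on U (fun y => dz (cplx_mx (Jrow (f y)) (f y))) <->
   forall x v, U x -> 'D_(Jrow v) f x = Jrow ('D_v f x)).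
Proof.
move=> df.
pose r := fun y => - (2 *: rsubmx (f y)); pose l := fun y => 2 *: lsubmx (f y).
have E : (fun y => dz (cplx_mx (Jrow (f y)) (f y))) =
         (fun y => cplx_mx (r y) (l y)).
  by apply/funext => y; rewrite dz_type10.
have Dr x v : U x -> 'D_v r x = - (2 *: rsubmx ('D_v f x)).
  by move=> /df; exact: (derive_lin (-%R \o *:%R 2 \o rsubmx)).
have Dl x v : U x -> 'D_v l x = 2 *: lsubmx ('D_v f x).
  by move=> /df; exact: (derive_lin ( *:%R 2 \o lsubmx)).
have s2 : injective ( *:%R 2 : 'rV[R]_n -> 'rV[R]_n).
  by apply: scalerI; rewrite pnatr_eq0.
rewrite E; split=> [hol x v Ux|CR x Ux].
  have [_ _ /(_ v) /(complex_linear_cderive _ _ erefl)] := hol x Ux.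
  rewrite !Dr// !Dl// => -[/oppr_inj/s2 hr]; rewrite -scalerN => /s2 hl.
  by rewrite -[LHS]hsubmxK hr hl.
split.
- have -> : (fun y => re_mx (cplx_mx (r y) (l y))) = r.
    by apply/funext => y; rewrite re_cplx.
  exact/(differentiable_lin (-%R \o *:%R 2 \o rsubmx))/df.
- have -> : (fun y => im_mx (cplx_mx (r y) (l y))) = l.
    by apply/funext => y; rewrite im_cplx.
  exact/(differentiable_lin ( *:%R 2 \o lsubmx))/df.
- move=> v; apply/(complex_linear_cderive _ _ erefl).
  by rewrite !Dr// !Dl// CR// /Jrow row_mxKl row_mxKr scalerN.
Qed.
End Holomorphy.

(** * Fields of type (1,0), Killing fields and the Chern connection *)

Section Inner.
Context {R : realType} {n : nat} (G : 'M[R]_(n + n)).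
Implicit Types u v w : 'rV[R]_(n + n).

Lemma innerBl u v w : inner G (u - v) w = inner G u w - inner G v w.
Proof. by rewrite /inner !mulmxBl !mxE. Qed.

Lemma innerBr u v w : inner G w (u - v) = inner G w u - inner G w v.
Proof. by rewrite /inner linearB mulmxBr !mxE. Qed.

Lemma innerNl u v : inner G (- u) v = - inner G u v.
Proof. by rewrite /inner !mulNmx !mxE. Qed.

End Inner.

Section Fields.
Context {R : realType} {n : nat} (M : complex_manifold R n).
Implicit Types (X Y U W : field_rep M) (a b : chart_index M).

Lemma vf_differentiable X a x :
  vector_field X -> img a x -> differentiable (X a) x.
Proof. by move=> [_ _ /(_ a 1)[+ _]]; apply. Qed.

(** [J] is defined chart by chart; it is compatible with changes of charts because
    these are holomorphic. *)
Lemma Jfield_vector_field X : vector_field X -> vector_field (Jfield X).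
Proof.
move=> hX; split=> [a x nx|a b p pa pb|a k].
- by rewrite /Jfield (vf_outside hX nx) linear0.
- rewrite /Jfield (vf_transform hX pa pb).
  have hol := @transition_holomorphic _ _ M a b.
  rewrite -(holomorphic_derive_J _ hol)//.
    by exists p.
  exact: transition_differentiable.
- apply: (Ck_on_linear_comp (L := @Jrow R n)).
  + exact: img_open.
  + exact: rV_linear_continuous.
  + exact: (vf_smooth hX).
Qed.

Lemma derive_Jfield X a x v : vector_field X -> img a x ->
  'D_v (Jfield X a) x = Jrow ('D_v (X a) x).
Proof.
by move=> hX ax; apply: (derive_lin (@Jrow R n)); exact: vf_differentiable.
Qed.

(** The general field of type (1,0): [J Z = i Z] forces the real part of [Z] to be
    [J] of its imaginary part. The imaginary part serves as parameter so that no
    sign appears. *)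
Definition type10 U : cfield_rep M := fun a x => cplx_mx (Jrow (U a x)) (U a x).

Lemma re_type10 U : re_field (type10 U) = Jfield U.
Proof. by apply/funext => a; apply/funext => x; exact: re_cplx. Qed.

Lemma im_type10 U : im_field (type10 U) = U.
Proof. by apply/funext => a; apply/funext => x; exact: im_cplx. Qed.

Lemma type10_T10 U : vector_field U -> T10_field (type10 U).
Proof.
move=> hU; split.
  by split; rewrite ?re_type10 ?im_type10//; exact: Jfield_vector_field.
by move=> a x _; rewrite /type10 Jrow_cplx scale_i_cplx JrowK.
Qed.

Lemma T10_type10 Z : T10_field Z -> Z = type10 (im_field Z).
Proof.
move=> [[hre him] hJ]; apply/funext => a; apply/funext => x.
rewrite /type10 -[LHS]cplx_re_im; congr cplx_mx.
have [ax|ax] := pselect (img a x); last first.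
  by rewrite (vf_outside him ax) linear0; exact: (vf_outside hre ax).
have := hJ a x ax; rewrite -{1 2}(cplx_re_im (Z a x)) Jrow_cplx scale_i_cplx.
by move=> /cplx_eq[_ <-].
Qed.

Definition cplx_field X Y : cfield_rep M := fun a x => cplx_mx (X a x) (Y a x).

Lemma re_cplx_field X Y : re_field (cplx_field X Y) = X.
Proof. by apply/funext => a; apply/funext => x; exact: re_cplx. Qed.

Lemma im_cplx_field X Y : im_field (cplx_field X Y) = Y.
Proof. by apply/funext => a; apply/funext => x; exact: im_cplx. Qed.

Lemma T01_cplx_field U : vector_field U -> T01_field (cplx_field U (Jfield U)).
Proof.
move=> hU; split.
  by split; rewrite ?re_cplx_field ?im_cplx_field//; exact: Jfield_vector_field.
move=> a x _; rewrite /cplx_field /Jfield Jrow_cplx scale_i_cplx opp_cplx opprK.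
by rewrite JrowK.
Qed.

(** The torsion-twisted derivative of [U], regarded as an operator on its direction
    [Y]: being Killing or holomorphic is a symmetry of this operator with respect
    to [g] or [J]. *)
Definition nabla_sub_lie (D : field_rep M -> field_rep M -> field_rep M) U Y
    : field_rep M :=
  fun a x => D U Y a x - bracket U Y a x.

Lemma torsion_twistedE D U Y : torsion_twisted D Y U = nabla_sub_lie D U Y.
Proof.
apply/funext => a; apply/funext => x.
rewrite /torsion_twisted /torsion /nabla_sub_lie /bracket.
move: (D Y U a x) (D U Y a x) ('D_(Y a x) (U a) x) ('D_(U a x) (Y a) x).
by move=> p q s t; apply/rowP => j; rewrite !mxE; ring.
Qed.

Section Chern.
Context (g : metric_rep M) (hg : hermitian_metric g).
Context (D : field_rep M -> field_rep M -> field_rep M).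
Context (hD : chern_connection g D).
Local Notation A := (nabla_sub_lie D).

(** The imaginary part of [nabla^{0,1} = dbar] for [U + i JU] and [JY + i Y]. *)
Lemma chern_dbar_real U Y a x : vector_field U -> vector_field Y -> img a x ->
  D U Y a x + Jrow (D (Jfield U) Y a x) =
  'D_(U a x) (Y a) x + Jrow ('D_(Jrow (U a x)) (Y a) x).
Proof.
move=> hU hY ax.
have := chern_dbar hD (T01_cplx_field hU) (type10_T10 hY) ax.
move=> /(congr1 im_mx).
rewrite /complexify re_cplx_field im_cplx_field re_type10 im_type10 im_cplx.
rewrite (chern_J hD (Jfield_vector_field hU) hY ax) => ->.
have dY := vf_differentiable hY ax.
rewrite /dbar /cplx_field /Jfield.
rewrite (_ : (fun y => dz (type10 Y a y)) =
  fun y => cplx_mx (- (2 *: rsubmx (Y a y))) (2 *: lsubmx (Y a y))); last first.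
  by apply/funext => y; exact: dz_type10.
rewrite cderive_cplx im_dz_frame.
rewrite !(derive_lin (-%R \o *:%R 2 \o rsubmx) _ dY).
rewrite !(derive_lin ( *:%R 2 \o lsubmx) _ dY)/=.
set p := 'D_ _ _ _; set q := 'D_ _ _ _; clearbody p q.
apply/rowP => j; rewrite -[p]hsubmxK -[q]hsubmxK /Jrow !row_mxKl !row_mxKr !mxE.
by case: (fintype.split j) => k; rewrite !mxE; field.
Qed.

(** On the left-hand side, the terms with [D] and the derivatives of [Y] in the
    brackets cancel by [chern_dbar_real]; the derivatives of [U] in the brackets
    remain. *)
Lemma nabla_sub_lie_dbar U Y a x :
  vector_field U -> vector_field Y -> img a x ->
  A U Y a x + A (Jfield U) (Jfield Y) a x =
  'D_(Y a x) (U a) x + Jrow ('D_(Jrow (Y a x)) (U a) x).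
Proof.
move=> hU hY ax; have := chern_dbar_real hU hY ax.
have JU : Jfield U a x = Jrow (U a x) by [].
have JY : Jfield Y a x = Jrow (Y a x) by [].
have JD : Jfield (D (Jfield U) Y) a x = Jrow (D (Jfield U) Y a x) by [].
rewrite /nabla_sub_lie (chern_J hD (Jfield_vector_field hU) hY ax) /bracket.
rewrite JU JY JD (derive_Jfield _ hU ax) (derive_Jfield _ hY ax).
have cancel (p q r s t u : 'rV[R]_(n + n)) :
    p + q = r + s -> p - (r - t) + (q - (s - u)) = t + u.
  by move=> E; rewrite !opprB addrACA E addrACA !subrKC.
exact: cancel.
Qed.

Lemma lie_metricE U Y W a x :
  vector_field U -> vector_field Y -> vector_field W -> img a x ->
  lie_metric g U Y W a x =
  inner (g a x) (A U Y a x) (W a x) + inner (g a x) (Y a x) (A U W a x).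
Proof.
move=> hU hY hW ax; rewrite /lie_metric (chern_metric hD hU hY hW ax).
rewrite /pairing /nabla_sub_lie innerBl innerBr; ring.
Qed.

Lemma killing_type10 U : vector_field U -> killing g (type10 U) <->
  forall Y W, vector_field Y -> vector_field W -> forall a x, img a x ->
    lie_metric g (Jfield U) Y W a x = 0 /\ lie_metric g U Y W a x = 0.
Proof.
move=> hU; rewrite /killing re_type10 im_type10.
split=> H Y W hY hW a x ax.
  have /eqP := H Y W hY hW a x ax.
  rewrite eq_complex /= => /andP[/eqP + /eqP].
  by rewrite !(mul0r, mulr0, mul1r, subr0, addr0, add0r, oppr0) => -> ->.
by have [-> ->] := H Y W hY hW a x ax; rewrite mulr0 addr0.
Qed.

Lemma parallel_type10 U : vector_field U ->
  parallel (torsion_twisted D) (type10 U) <->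
  forall Y, vector_field Y -> forall a x, img a x ->
    A (Jfield U) Y a x = 0 /\ A U Y a x = 0.
Proof.
move=> hU; rewrite /parallel /complexify re_type10 im_type10.
split=> [H Y hY a x ax|H X [hre him] a x ax]; last first.
  rewrite !torsion_twistedE.
  have [-> ->] := H _ hre a x ax; have [-> ->] := H _ him a x ax.
  by rewrite subr0 addr0; apply/rowP => j; rewrite !mxE/= mulr0 addr0.
(* For [X = Y + i Y] the two components are the difference and the sum of
   [A (Jfield U) Y] and [A U Y]. *)
have hYY : cvector_field (cplx_field Y Y).
  by split; rewrite ?re_cplx_field ?im_cplx_field.
have := H _ hYY a x ax.
rewrite re_cplx_field im_cplx_field !torsion_twistedE => E.
have difference_sum (p q : 'rV[R]_(n + n)) :
    p - q = re_mx 0 -> q + p = im_mx 0 -> p = 0 /\ q = 0.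
  move=> /rowP E1 /rowP E2; split; apply/rowP => j;
    by have := E1 j; have := E2 j; rewrite !mxE/=; lra.
by apply: difference_sum; rewrite -E ?re_cplx ?im_cplx.
Qed.

Lemma parallel_iff_holomorphic_killing U : vector_field U ->
  parallel (torsion_twisted D) (type10 U) <->
  holomorphic_field (type10 U) /\ killing g (type10 U).
Proof.
move=> hU; have hJU := Jfield_vector_field hU.
have dU a x (ax : img a x) := vf_differentiable hU ax.
have holE a := holomorphic_type10 (dU a).
rewrite parallel_type10// killing_type10//; split=> [par|[[_ hol] kill]].
  split; last first.
    move=> Y W hY hW a x ax; rewrite !lie_metricE//.
    have [-> ->] := par Y hY a x ax; have [-> ->] := par W hW a x ax.
    by rewrite /inner linear0 mulmx0 !mul0mx mxE addr0.
  split; first exact: type10_T10.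
  move=> a; apply/holE => x v ax.
  have [Y hY <-] := exists_vector_field v ax.
  have := nabla_sub_lie_dbar hU hY ax.
  have [_ ->] := par Y hY a x ax.
  have [-> _] := par (Jfield Y) (Jfield_vector_field hY) a x ax.
  rewrite addr0 => /esym/(congr1 (@Jrow R n)); rewrite linearD linear0/= JrowK.
  by move=> /eqP; rewrite subr_eq0 => /eqP <-.
have {}hol a x v : img a x -> 'D_(Jrow v) (U a) x = Jrow ('D_v (U a) x).
  by move=> ax; exact: ((holE a).1 (hol a)).
have AJ Y a x : vector_field Y -> img a x ->
    A (Jfield U) (Jfield Y) a x = Jrow (A (Jfield U) Y a x).
  move=> hY ax; rewrite /nabla_sub_lie (chern_J hD hJU hY ax) /bracket.
  have JY : Jfield Y a x = Jrow (Y a x) by [].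
  have JD : Jfield (D (Jfield U) Y) a x = Jrow (D (Jfield U) Y a x) by [].
  rewrite JY JD !(derive_Jfield _ hU ax) (derive_Jfield _ hY ax) hol//.
  by rewrite !linearB.
have AUJ Y a x : vector_field Y -> img a x ->
    A (Jfield U) Y a x = Jrow (A U Y a x).
  move=> hY ax; have := nabla_sub_lie_dbar hU hY ax.
  rewrite hol// JrowK subrr AJ// => /(congr1 (@Jrow R n)).
  rewrite linearD linear0/= JrowK => /eqP.
  by rewrite subr_eq0 => /eqP ->.
(* Skewness of both operators, the first one with [JY] for [Y]. *)
have orth Y W a x : vector_field Y -> vector_field W -> img a x ->
    inner (g a x) (A U Y a x) (W a x) = 0.
  move=> hY hW ax; have hJY := Jfield_vector_field hY.
  have [+ _] := kill _ _ hJY hW a x ax; have [_] := kill _ _ hY hW a x ax.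
  rewrite !lie_metricE// AJ// !AUJ// JrowK innerNl (metric_J hg)//.
  lra.
have A0 Y a x : vector_field Y -> img a x -> A U Y a x = 0.
  move=> hY ax; apply/eqP/negPn/negP => nz.
  have [W hW Wx] := exists_vector_field (A U Y a x) ax.
  by have := metric_pos hg ax nz; rewrite -{2}Wx orth// ltxx.
by move=> Y hY a x ax; rewrite AUJ// A0// linear0.
Qed.

End Chern.
End Fields.

Theorem proposition3p3 (R : realType) (n : nat) (M : complex_manifold R n)
    (g : metric_rep M) (hg : hermitian_metric g)
    (nabla : field_rep M -> field_rep M -> field_rep M)
    (hnabla : chern_connection g nabla)
    (zeta : cfield_rep M) (hzeta : T10_field zeta) :
  parallel (torsion_twisted nabla) zeta <->
  holomorphic_field zeta /\ killing g zeta.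
Proof.
rewrite (T10_type10 hzeta); apply: parallel_iff_holomorphic_killing => //.
by case: hzeta => -[].
Qed.
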